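(* If the permutation class $\mathcal{C}$ is labelled well-quasi-ordered (lwqo), then its substitution closure $\langle\mathcal{C}\rangle$ is also lwqo.
   Context: A permutation of length $n$ is an arrangement $\pi=\pi(1)\cdots\pi(n)$ of $1,\dots,n$ (the empty permutation is allowed). The permutation $\sigma$ of length $k$ is contained in $\pi$ of length $n$, written $\sigma\le\pi$, if there are indices $1\le i_1<\cdots<i_k\le n$ such that $\pi(i_1)\cdots\pi(i_k)$ is order isomorphic to $\sigma$. A permutation class is a set of permutations closed downward under containment. Given a permutation $\sigma$ of length $m$ and nonempty permutations $\alpha_1,\dots,\alpha_m$, the inflation $\sigma[\alpha_1,\dots,\alpha_m]$ is the permutation of length $|\alpha_1|+\cdots+|\alpha_m|$ obtained by replacing each entry $\sigma(i)$ by an interval (a set of entries with contiguous positions and contiguous values) order isomorphic to $\alpha_i$, so that the intervals are themselves order isomorphic to $\sigma$. For classes $\mathcal{C},\mathcal{U}$, $\mathcal{C}[\mathcal{U}]$ is the set of all $\sigma[\alpha_1,\dots,\alpha_m]$ with $\sigma\in\mathcal{C}$ of length $m$ and $\alpha_1,\dots,\alpha_m\in\mathcal{U}$ nonempty. A class $\mathcal{D}$ is substitution closed if $\mathcal{D}[\mathcal{D}]\subseteq\mathcal{D}$, and $\langle\mathcal{C}\rangle$ is the smallest substitution closed class containing $\mathcal{C}$. A quasi-order $(Y,\le)$ is well-quasi-ordered (wqo) if every infinite sequence $y_1,y_2,\dots$ in $Y$ has indices $i<j$ with $y_i\le y_j$. Given a quasi-order $(L,\le_L)$, an $L$-labelled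 permutation is a pair $(\pi,\ell_\pi)$ with $\pi$ a permutation of length $n$ and $\ell_\pi:\{1,\dots,n\}\to L$. We say $(\sigma,\ell_\sigma)\le(\pi,\ell_\pi)$, where $\sigma$ and $\pi$ have lengths $k$ and $n$, if there are indices $1\le i_1<\cdots<i_k\le n$ such that $\pi(i_1)\cdots\pi(i_k)$ is order isomorphic to $\sigma$ and $\ell_\sigma(j)\le_L\ell_\pi(i_j)$ for all $1\le j\le k$. For a set $X$ of permutations, $X\wr L$ is the set of all $L$-labelled members of $X$ under this order. The set $X$ is lwqo if $X\wr L$ is wqo for every wqo $(L,\le_L)$. *)

(* Defs.v *)
From Corelib Require Import RelationClasses.
From mathcomp Require Import all_boot all_fingroup.

Set Implicit Arguments.
Unset Strict Implicit.
Unset Printing Implicit Defensive.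

(* Positions and values are numbered from 0; [plen] may be 0. *)
Record permutation := Permutation { plen : nat; pperm :> 'S_plen }.

(* [f] lists the indices i_1 < ... < i_k of a copy of [sigma] inside [pi]. *)
Definition occurrence (sigma pi : permutation)
    (f : 'I_(plen sigma) -> 'I_(plen pi)) : Prop :=
  (forall i j : 'I_(plen sigma), i < j -> f i < f j) /\
  (forall i j : 'I_(plen sigma), (pi (f i) < pi (f j)) = (sigma i < sigma j)).
Arguments occurrence : clear implicits.

Definition contained (sigma pi : permutation) : Prop :=
  exists f : 'I_(plen sigma) -> 'I_(plen pi), occurrence sigma pi f.

Definition permutation_class (C : permutation -> Prop) : Prop :=
  forall sigma pi : permutation, contained sigma pi -> C pi -> C sigma.

Definition contiguous (n : nat) (A : {set 'I_n}) : Prop :=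
  forall x y z : 'I_n, x \in A -> z \in A -> x <= y <= z -> y \in A.

(* Here [A] is the set of positions of the entries. *)
Definition is_interval (pi : permutation) (A : {set 'I_(plen pi)}) : Prop :=
  contiguous A /\ contiguous [set pi x | x in A].
Arguments is_interval : clear implicits.

Definition order_isomorphic_on (pi : permutation) (A : {set 'I_(plen pi)})
    (alpha : permutation) : Prop :=
  exists f : 'I_(plen alpha) -> 'I_(plen pi),
    occurrence alpha pi f /\ [set f x | x : 'I_(plen alpha)] = A.
Arguments order_isomorphic_on : clear implicits.

(* pi = sigma[alpha_1, ..., alpha_m].  The last clause says that the intervals
   are order isomorphic to [sigma]; it makes them pairwise disjoint, and with
   the length condition they cover all the entries of [pi]. *)
Definition is_inflation (sigma : permutation)
    (alpha : 'I_(plen sigma) -> permutation) (pi : permutation) : Prop :=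
  plen pi = \sum_(i < plen sigma) plen (alpha i) /\
  exists B : 'I_(plen sigma) -> {set 'I_(plen pi)},
    [/\ forall i, is_interval pi (B i),
        forall i, order_isomorphic_on pi (B i) (alpha i) &
        forall (i j : 'I_(plen sigma)) (x y : 'I_(plen pi)),
          i != j -> x \in B i -> y \in B j ->
          (x < y) = (i < j) /\ (pi x < pi y) = (sigma i < sigma j)].
Arguments is_inflation : clear implicits.

Definition inflations (C U : permutation -> Prop) (pi : permutation) : Prop :=
  exists (sigma : permutation) (alpha : 'I_(plen sigma) -> permutation),
    [/\ C sigma,
        forall i, U (alpha i) /\ 0 < plen (alpha i) &
        is_inflation sigma alpha pi].

Definition substitution_closed (D : permutation -> Prop) : Prop :=
  forall pi : permutation, inflations D D pi -> D pi.

Definition substitution_closure (C : permutation -> Prop)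
    (pi : permutation) : Prop :=
  forall D : permutation -> Prop,
    permutation_class D -> substitution_closed D ->
    (forall sigma, C sigma -> D sigma) -> D pi.

Lemma substitution_closure_least (C : permutation -> Prop) :
  [/\ permutation_class (substitution_closure C),
      substitution_closed (substitution_closure C),
      forall sigma, C sigma -> substitution_closure C sigma &
      forall D : permutation -> Prop,
        permutation_class D -> substitution_closed D ->
        (forall sigma, C sigma -> D sigma) ->
        forall pi, substitution_closure C pi -> D pi].
Proof.
split.
- move=> s p sp Cp D Dc Ds CD; exact: (Dc _ _ sp (Cp D Dc Ds CD)).
- move=> p [s [a [Cs Ca sap]]] D Dc Ds CD; apply: (Ds); exists s, a.
  split; [exact: (Cs D Dc Ds CD) | | exact: sap].
  by move=> i; have [Cai ai0] := Ca i; split; [exact: (Cai D Dc Ds CD) | exact: ai0].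
- by move=> s Cs D _ _ CD; exact: (CD s Cs).
- by move=> D Dc Ds CD p Cp; exact: (Cp D Dc Ds CD).
Qed.

Definition wqo (Y : Type) (le : Y -> Y -> Prop) : Prop :=
  PreOrder le /\
  forall y : nat -> Y, exists i j : nat, i < j /\ le (y i) (y j).

Record labelled_permutation (L : Type) := LabelledPermutation {
  lperm : permutation;
  label : 'I_(plen lperm) -> L }.

Definition labelled_contained (L : Type) (leL : L -> L -> Prop)
    (s p : labelled_permutation L) : Prop :=
  exists f : 'I_(plen (lperm s)) -> 'I_(plen (lperm p)),
    occurrence (lperm s) (lperm p) f /\ forall j, leL (label j) (label (f j)).

(* The carrier of the wreath product of [X] and [L], and its order. *)
Definition wreath (X : permutation -> Prop) (L : Type) : Type :=
  {p : labelled_permutation L | X (lperm p)}.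

Definition wreath_le (X : permutation -> Prop) (L : Type)
    (leL : L -> L -> Prop) (s p : wreath X L) : Prop :=
  labelled_contained leL (sval s) (sval p).

Definition lwqo (X : permutation -> Prop) : Prop :=
  forall (L : Type) (leL : L -> L -> Prop),
    wqo leL -> wqo (@wreath_le X L leL).

(* Main.v *)
(** The permutations with a tree decomposition whose nodes are in [C] form a
    substitution closed class containing [C], so it suffices that they are lwqo.
    Take a bad sequence of labelled such permutations that is minimal with
    respect to length.  By minimality the strictly shorter labelled permutations
    contained in its terms are well-quasi-ordered, and so are the labelled
    permutations of length one.  Every term is an inflation of a member of [C] by
    permutations of these two kinds; regarding each block as the label of the
    corresponding entry of the member of [C], the lwqo hypothesis provides two
    comparable terms. *)

From Corelib Require Import RelationClasses.
From Stdlib Require Import Classical IndefiniteDescription.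
From mathcomp Require Import all_boot all_fingroup.
Require Import Defs.

Set Implicit Arguments.
Unset Strict Implicit.
Unset Printing Implicit Defensive.

(** The type of the witness may vary with the index, as for embeddings of the different blocks of an
    inflation. *)
Lemma dependent_functional_choice (A : Type) (B : A -> Type)
    (R : forall x, B x -> Prop) :
  (forall x, exists y, R x y) -> exists f : forall x, B x, forall x, R x (f x).
Proof.
move=> exR; pose f x := constructive_indefinite_description _ (exR x).
by exists (fun x => sval (f x)) => x; apply: svalP.
Qed.

(** * Good and bad sequences *)

Definition good_on (X : Type) (le : X -> X -> Prop) (P : X -> Prop) : Prop :=
  forall y : nat -> X, (forall n, P (y n)) ->
    exists i j : nat, i < j /\ le (y i) (y j).

Definition bad_sequence (X : Type) (le : X -> X -> Prop) (P : X -> Prop)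
    (y : nat -> X) : Prop :=
  (forall n, P (y n)) /\ forall i j, i < j -> ~ le (y i) (y j).

Lemma good_onPn (X : Type) (le : X -> X -> Prop) (P : X -> Prop) :
  (forall y, ~ bad_sequence le P y) -> good_on le P.
Proof.
move=> nobad y Py; apply: NNPP => ngood; apply: (nobad y); split=> // i j ij leij.
by apply: ngood; exists i, j.
Qed.

Lemma exists_argmin (X : Type) (P : X -> Prop) (m : X -> nat) :
  (exists x, P x) -> exists x, P x /\ forall y, P y -> m x <= m y.
Proof.
move=> [x Px]; have [n mx] := ubnP (m x).
elim: n x Px mx => // n IHn x Px mx.
case: (classic (exists y, P y /\ m y < m x)) => [[y [Py ltyx]]|nlt].
  by apply: (IHn y) => //; apply: leq_trans ltyx _; rewrite -ltnS.
exists x; split=> // y Py; rewrite leqNgt; apply/negP=> ltyx.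
by apply: nlt; exists y.
Qed.

(** A sequence either stays in [Q] from some index on, or meets [P] infinitely often and so has a
    subsequence in [P]. *)
Lemma good_onU (X : Type) (le : X -> X -> Prop) (P Q : X -> Prop) :
  good_on le P -> good_on le Q -> good_on le (fun x => P x \/ Q x).
Proof.
move=> goodP goodQ y PQy.
case: (classic (exists N, forall n, N <= n -> Q (y n))) => [[N QN]|noN].
  have [|i [j [ij leij]]] := goodQ (fun n => y (N + n)).
    by move=> n; apply: QN; rewrite leq_addr.
  by exists (N + i), (N + j); rewrite ltn_add2l.
have Pinf N : exists n, N <= n /\ P (y n).
  apply: NNPP => noP; apply: noN; exists N => n Nn.
  by case: (PQy n) => // Pn; case: noP; exists n.
have [g gP] := functional_choice _ Pinf.
pose h := fix h k := if k is k'.+1 then g (h k').+1 else g 0.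
have hS k : h k < h k.+1 by have [] := gP (h k).+1.
have h_incr i j : i < j -> h i < h j.
  elim: j => // j IHj; rewrite ltnS leq_eqVlt => /predU1P[->//|/IHj hij].
  exact: ltn_trans hij (hS j).
have [|i [j [ij leij]]] := goodP (y \o h).
  by case=> [|k] /=; [have [] := gP 0 | have [] := gP (h k).+1].
by exists (h i), (h j); split; [apply: h_incr|].
Qed.

(** Nash-Williams' construction: term [n] has least measure among those extending the terms already
    chosen to a bad sequence; the result is the diagonal of the successive sequences. *)
Lemma minimal_bad_sequence (X : Type) (le : X -> X -> Prop) (P : X -> Prop)
    (m : X -> nat) (y0 : nat -> X) :
  bad_sequence le P y0 ->
  exists2 y, bad_sequence le P y &
    forall n z, bad_sequence le P z -> (forall i, i < n -> z i = y i) ->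
      m (y n) <= m (z n).
Proof.
move=> bad0.
(* [a] holds an index and the current sequence. Badness as a premise keeps the choice function
   total, with [y0] as a dummy value. *)
have step (a : nat * (nat -> X)) : exists z, bad_sequence le P a.2 ->
    (bad_sequence le P z /\ forall i, i < a.1 -> z i = a.2 i) /\
    forall w, bad_sequence le P w /\ (forall i, i < a.1 -> w i = a.2 i) ->
      m (z a.1) <= m (w a.1).
  case: (classic (bad_sequence le P a.2)) => [bada|nbad]; last by exists y0.
  have [|z zP] := @exists_argmin _
    (fun z => bad_sequence le P z /\ forall i, i < a.1 -> z i = a.2 i)
    (fun z => m (z a.1)); first by exists a.2.
  by exists z.
have [next nextP] := functional_choice _ step.
pose h := fix h n := if n is n'.+1 then next (n, h n') else next (0, y0).
have bad_h n : bad_sequence le P (h n).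
  elim: n => [|n IHn] /=; first by have [[]] := nextP (0, y0) bad0.
  by have [[]] := nextP (n.+1, h n) IHn.
have h_stable n i : i <= n -> h n i = h i i.
  elim: n => [|n IHn]; first by rewrite leqn0 => /eqP->.
  rewrite leq_eqVlt => /predU1P[->//|ltin].
  have [[_ agree] _] := nextP (n.+1, h n) (bad_h n).
  by rewrite -IHn //; apply: agree.
exists (fun n => h n n).
  split=> [n|i j ij]; first by case: (bad_h n).
  by rewrite -(@h_stable j i (ltnW ij)); case: (bad_h j) => _; apply.
case=> [|n] z badz agree.
  by have [_] := nextP (0, y0) bad0; apply.
have [_] := nextP (n.+1, h n) (bad_h n); apply; split=> // i /= ltin.
by rewrite agree // h_stable.
Qed.

(** A tail of a bad sequence [z] of such elements, grafted onto an initial segment of [y], would be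
    a bad sequence against the minimality of [y]. *)
Lemma minimal_bad_sequence_good (X : Type) (le : X -> X -> Prop)
    (P : X -> Prop) (m : X -> nat) (y : nat -> X) :
  Transitive le -> bad_sequence le P y ->
  (forall n z, bad_sequence le P z -> (forall i, i < n -> z i = y i) ->
     m (y n) <= m (z n)) ->
  good_on le (fun x => P x /\ exists n, le x (y n) /\ m x < m (y n)).
Proof.
move=> le_tr [Py bady] ymin; apply: good_onPn => z [zP badz].
have [n nP] := functional_choice _ (fun k => (zP k).2).
(* With [n k0] least, a relation from a kept term [y i] to some [z k] passes on to [y (n k)], and
   [i < n k0 <= n k] contradicts the badness of [y]. *)
have [k0 [_ k0min]] := @exists_argmin _ (fun=> True) n (ex_intro _ 0 I).
pose w i := if i < n k0 then y i else z (k0 + (i - n k0)).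
suff badw : bad_sequence le P w.
  have := ymin (n k0) w badw; rewrite {2}/w ltnn subnn addn0.
  move=> H; have: m (y (n k0)) <= m (z k0).
    by apply: H => i; rewrite /w => ->.
  by rewrite leqNgt (nP k0).2.
split=> [i|i j ij]; rewrite /w; first by case: ifP => // _; case: (zP (k0 + (i - n k0))).
case: (ltnP j (n k0)) => [ltj|lej].
  by rewrite (ltn_trans ij ltj); apply: bady.
case: (ltnP i (n k0)) => [lti|lei].
  set k := k0 + _ => leyz; apply: (bady i (n k)).
    by apply: leq_trans lti _; apply: k0min.
  exact: le_tr leyz (nP k).1.
by apply: badz; rewrite ltn_add2l ltn_sub2r // (leq_ltn_trans lei ij).
Qed.

(** * Occurrences and block maps *)

Lemma occurrence_inj (s p : permutation) f : occurrence s p f -> injective f.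
Proof.
move=> [mono _] i j fij; apply: val_inj; apply/eqP.
by case: ltngtP => // /mono; rewrite fij ltnn.
Qed.

Lemma occurrence_ltn (s p : permutation) f :
  occurrence s p f -> forall i j, (f i < f j) = (i < j).
Proof.
move=> [mono _] i j; case: (ltngtP i j) => [/mono//|/mono ji|/val_inj->].
  by rewrite ltnNge (ltnW ji).
exact: ltnn.
Qed.

Lemma occurrence_id (p : permutation) : occurrence p p id.
Proof. by []. Qed.

Lemma occurrence_comp (s p q : permutation) f g :
  occurrence s p f -> occurrence p q g -> occurrence s q (g \o f).
Proof.
move=> [f1 f2] [g1 g2]; split=> i j /=; first by move=> /f1/g1.
by rewrite g2 f2.
Qed.

Lemma order_isomorphic_on_card (p : permutation) A (s : permutation) :
  order_isomorphic_on p A s -> plen s = #|A|.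
Proof. by move=> [f [/occurrence_inj finj <-]]; rewrite card_imset // card_ord. Qed.

(** Standardisation: [i] goes to the number of values below [v i]. *)
Lemma rank_perm (n : nat) (v : 'I_n -> nat) : injective v ->
  exists s : 'S_n, forall i j, (s i < s j) = (v i < v j).
Proof.
move=> vinj; pose below i := [set j | v j < v i].
have below_lt i : #|below i| < n.
  rewrite -[X in _ < X]card_ord; apply: proper_card.
  by apply/properP; split; [apply/subsetP | exists i => //; rewrite inE ltnn].
have mono i j : v i < v j -> #|below i| < #|below j|.
  move=> ij; apply: proper_card; apply/properP; split.
    by apply/subsetP=> k; rewrite !inE => /ltn_trans; apply.
  by exists i; rewrite !inE ?ltnn.
pose r i := Ordinal (below_lt i).
have rE i j : (r i < r j) = (v i < v j).
  case: (ltngtP (v i) (v j)) => [/mono //|/mono ji|/vinj->]; last exact: ltnn.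
  by rewrite /= ltnNge (ltnW ji).
have rinj : injective r.
  move=> i j rij; apply: vinj; apply/eqP; move: (rE i j) (rE j i).
  by rewrite rij ltnn; case: ltngtP.
by exists (perm rinj) => i j; rewrite !permE.
Qed.

Lemma exists_pattern (p : permutation) (A : {set 'I_(plen p)}) :
  exists s, order_isomorphic_on p A s.
Proof.
pose f (i : 'I_#|A|) := enum_val i.
have mono (i j : 'I_#|A|) : i < j -> f i < f j.
  (* [enum] lists a set of ordinals increasingly. *)
  have srt : sorted ltn [seq val x | x <- enum A].
    rewrite /enum_mem -enumT sorted_map; apply: sorted_filter.
      by move=> x y z; apply: ltn_trans.
    by rewrite -sorted_map val_enum_ord iota_ltn_sorted.
  move=> ij; have ltA (k : 'I_#|A|) : k < size (enum A) by rewrite -cardE.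
  have x0 : 'I_(plen p) := f i.
  rewrite /f !(enum_val_nth x0) -!(nth_map x0 0 val) //.
  by apply: (sorted_ltn_nth ltn_trans) => //; rewrite inE size_map.
have finj : injective (fun i => p (f i) : nat).
  by move=> i j /val_inj/perm_inj/enum_val_inj.
have [s sE] := rank_perm finj.
exists (Permutation s); exists f; split; first by split.
apply/setP=> x; apply/imsetP/idP=> [[i _ ->]|Ax]; first exact: enum_valP.
by exists (enum_rank_in Ax x) => //; rewrite /f enum_rankK_in.
Qed.

(** An inflation with the fibres of [b] as blocks, empty ones allowed. Fibres are automatically
    intervals: an entry outside a fibre lies on one side of it in position and in value. *)
Definition block_map (p s : permutation) (b : 'I_(plen p) -> 'I_(plen s)) :
    Prop :=
  forall x y, b x <> b y ->
    (x < y) = (b x < b y) /\ (p x < p y) = (s (b x) < s (b y)).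
Arguments block_map : clear implicits.

Lemma block_map_comp (q p s : permutation) g b :
  block_map q p g -> block_map p s b -> block_map q s (b \o g).
Proof.
move=> gP bP x y /= bxy; have gxy : g x <> g y by move=> e; apply: bxy; rewrite e.
by have [-> ->] := gP x y gxy; apply: bP.
Qed.

Lemma block_map_occurrence (q p : permutation) g :
  occurrence q p g -> block_map q p g.
Proof. by move=> gP x y _; rewrite (occurrence_ltn gP) gP.2. Qed.

Lemma block_map_lift (p s t : permutation) b g h :
  block_map p s b -> occurrence t s g -> (forall x, g (h x) = b x) ->
  block_map p t h.
Proof.
move=> bP gP ghE x y hxy.
rewrite -(occurrence_ltn gP) -gP.2 !ghE; apply: bP.
by rewrite -!ghE => /(occurrence_inj gP).
Qed.

(** The separation clause makes the intervals disjoint and the length condition makes them cover, so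
    [b] can send a position to the index of its interval. *)
Lemma inflation_block_map (s : permutation) alpha (p : permutation) :
  is_inflation s alpha p ->
  exists2 b, block_map p s b &
    forall i, order_isomorphic_on p [set x | b x == i] (alpha i).
Proof.
move=> [lenp [B [_ isoB sepB]]].
have disjB i j : i != j -> [disjoint B i & B j].
  move=> ij; apply/pred0P=> x /=; apply/negP=> /andP[xi xj].
  have [] := sepB i j x x ij xi xj; have [] := sepB j i x x _ xj xi.
    by rewrite eq_sym.
  rewrite !ltnn => ji _ ij' _; move: ij; rewrite -val_eqE.
  by case: ltngtP ij' ji.
have cover : \bigcup_i B i = setT.
  apply/eqP; rewrite eqEcard subsetT cardsT card_ord /=.
  apply: leq_trans (eq_leq lenp) _.
  rewrite -sum1_card (partition_disjoint_bigcup _ _ disjB).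
  by apply: leq_sum => i _; rewrite sum1_card (order_isomorphic_on_card (isoB i)).
have inB x : exists i, x \in B i.
  have: x \in \bigcup_i B i by rewrite cover inE.
  by case/bigcupP=> i _ xi; exists i.
have [b bP] := functional_choice _ inB; exists b.
  by move=> x y /eqP bxy; apply: (sepB _ _ _ _ bxy).
move=> i; suff -> : [set x | b x == i] = B i by [].
apply/setP=> x; rewrite inE; apply/eqP/idP=> [<-//|xi].
apply/eqP; apply: contraT => /disjB/pred0P/(_ x) /=.
by rewrite bP xi.
Qed.

Lemma contained_factor (a s p : permutation) f g :
  occurrence a p f -> occurrence s p g ->
  (forall x, f x \in [set g y | y : 'I_(plen s)]) -> contained a s.
Proof.
move=> fP gP fg.
have fgE x : exists y, g y = f x by have /imsetP[y _ ->] := fg x; exists y.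
have [h hE] := functional_choice _ fgE; exists h; split=> i j.
  by rewrite -(occurrence_ltn gP) !hE; apply: fP.1.
by rewrite -gP.2 !hE fP.2.
Qed.

(** * Tree decompositions *)

(* Quantifying over all patterns inside the fibres of the block map, rather than
   over the blocks themselves, makes closure under containment immediate. *)
Inductive decomposable (C : permutation -> Prop) (p : permutation) : Prop :=
| decomposable_leaf : C p -> decomposable C p
| decomposable_node (s : permutation) (b : 'I_(plen p) -> 'I_(plen s)) :
    C s -> block_map p s b ->
    (forall i a f, occurrence a p f -> (forall x, b (f x) = i) ->
       decomposable C a) ->
    decomposable C p.

Lemma decomposable_class (C : permutation -> Prop) :
  permutation_class C -> permutation_class (decomposable C).
Proof.
move=> hC q p [g gP] [Cp|s b Cs bP dec].
  by apply: decomposable_leaf; apply: (hC q p) => //; exists g.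
apply: (decomposable_node Cs
  (block_map_comp (block_map_occurrence gP) bP)) => i a f fP bgf.
exact: (dec i a (g \o f) (occurrence_comp fP gP)).
Qed.

(** Induction on the tree of [s]: a node of [s] with block map [c] becomes a node of [p] with block
    map [c \o b]. *)
Lemma decomposable_block_map (C : permutation -> Prop) (s : permutation) :
  decomposable C s -> forall p b, block_map p s b ->
  (forall i a f, occurrence a p f -> (forall x, b (f x) = i) ->
     decomposable C a) ->
  decomposable C p.
Proof.
elim=> {s} [s Cs p b bP dec|s t c Ct cP _ IHs p b bP dec].
  exact: (decomposable_node Cs bP dec).
apply: (decomposable_node Ct (block_map_comp bP cP)) => k a f fP cbf.
(* [r] is the pattern of [s] on the fibre of [c] over [k]; [b] induces a block map [h] from [a] to
   [r], to which the induction hypothesis applies. *)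
have [r [g [gP gE]]] := exists_pattern [set i | c i == k].
have gh x : exists y, g y = b (f x).
  have: b (f x) \in [set i | c i == k] by rewrite inE; apply/eqP/cbf.
  by rewrite -gE => /imsetP[y _ ->]; exists y.
have [h hE] := functional_choice _ gh.
apply: (IHs k r g gP _ a h).
- move=> y; apply/eqP; have: g y \in [set g z | z : 'I_(plen r)] by apply: imset_f.
  by rewrite gE inE.
- exact: (block_map_lift (block_map_comp (block_map_occurrence fP) bP) gP hE).
move=> i a' f' f'P hf'.
apply: (dec (g i) a' (f \o f') (occurrence_comp f'P fP)) => x /=.
by rewrite -hE hf'.
Qed.

Lemma decomposable_substitution_closed (C : permutation -> Prop) :
  permutation_class C -> substitution_closed (decomposable C).
Proof.
move=> hC p [s [alpha [Ds Dalpha /inflation_block_map[b bP isob]]]].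
apply: (decomposable_block_map Ds bP) => i a f fP bf.
have [g [gP gE]] := isob i.
apply: (decomposable_class hC _ (Dalpha i).1); apply: (contained_factor fP gP).
by move=> x; rewrite gE inE; apply/eqP/bf.
Qed.

(** Nodes with a constant block map are skipped, down to one that really splits [p] or to a leaf,
    where [p] is an inflation of itself by single entries. *)
Lemma decomposable_proper (C : permutation -> Prop) (p : permutation) :
  decomposable C p ->
  exists s b, [/\ C s, block_map p s b &
    forall i, #|[set x | b x == i]| = 1 \/ #|[set x | b x == i]| < plen p].
Proof.
elim=> {p} [p Cp|p s b Cs bP _ IH].
  exists p, id; split=> // i; left.
  by rewrite -(cards1 i); apply: eq_card => x; rewrite !inE.
case: (classic (exists i, forall x, b x = i)) => [[i bi]|nbi].
  exact: (IH i p id (occurrence_id p)).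
exists s, b; split=> // i; right; rewrite -[X in _ < X]card_ord -cardsT.
apply: proper_card; rewrite properT; apply/eqP=> /setP full.
by apply: nbi; exists i => x; have := full x; rewrite !inE => /eqP.
Qed.

(** * Labelled permutations *)

Section Labelled.

Variables (L : Type) (leL : L -> L -> Prop).

Lemma labelled_contained_preorder :
  PreOrder leL -> PreOrder (labelled_contained leL).
Proof.
move=> [leL_refl leL_tr]; split=> [p|p q r [f [fP fl]] [g [gP gl]]].
  by exists id; split.
exists (g \o f); split=> [|j /=]; first exact: occurrence_comp fP gP.
exact: leL_tr (fl j) (gl _).
Qed.

Lemma good_on_short : wqo leL ->
  good_on (labelled_contained leL) (fun p => plen (lperm p) = 1).
Proof.
move=> [_ goodL] y y1.
pose z n := label (cast_ord (esym (y1 n)) ord0).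
have [i [j [ij leij]]] := goodL z; exists i, j; split=> //.
have all_eq n (x : 'I_(plen (lperm (y n)))) : x = cast_ord (esym (y1 n)) ord0.
  apply: val_inj => /=; apply/eqP; rewrite -leqn0 -ltnS.
  exact: leq_trans (ltn_ord x) (eq_leq (y1 n)).
exists (fun=> cast_ord (esym (y1 j)) ord0); split=> [|x]; last by rewrite (all_eq i x).
by split=> x x'; rewrite (all_eq i x) (all_eq i x') !ltnn.
Qed.

(* [w], whose labels are themselves labelled permutations via [block], is a
   description of [p] as an inflation; blocks may be empty. *)
Definition assembles (Q : Type) (block : Q -> labelled_permutation L)
    (w : labelled_permutation Q) (p : labelled_permutation L) : Prop :=
  exists2 b, block_map (lperm p) (lperm w) b &
    forall i, exists e, [/\ occurrence (lperm (block (label i))) (lperm p) e,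
      [set e x | x : 'I_(plen (lperm (block (label i))))] = [set x | b x == i] &
      forall x, label (e x) = label x].

(** The embeddings [h] of the blocks are glued along [f]: entries of one block compare as in that
    block, entries of distinct blocks as in [w]. *)
Lemma assembles_contained (Q : Type) (block : Q -> labelled_permutation L)
    w w' p p' :
  assembles block w p -> assembles block w' p' ->
  labelled_contained
    (fun q q' => labelled_contained leL (block q) (block q')) w w' ->
  labelled_contained leL p p'.
Proof.
move=> [b bP blkP] [b' b'P blkP'] [f [fP hP]].
have finj := occurrence_inj fP.
have [e eP] := dependent_functional_choice blkP.
have [e' e'P] := dependent_functional_choice blkP'.
have [h hE] := dependent_functional_choice hP.
have be i j : b (e i j) = i.
  have [_ eE _] := eP i; apply/eqP.
  have: e i j \in [set e i x | x : _] by apply: imset_f.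
  by rewrite eE inE.
have be' i j : b' (e' i j) = i.
  have [_ eE _] := e'P i; apply/eqP.
  have: e' i j \in [set e' i x | x : _] by apply: imset_f.
  by rewrite eE inE.
have preP x : exists y, e (b x) y = x.
  have [_ eE _] := eP (b x).
  have: x \in [set z | b z == b x] by rewrite inE.
  by rewrite -eE => /imsetP[y _ xE]; exists y; rewrite -xE.
(* [pre x] is the position of [x] within its own block. *)
have [pre preK] := dependent_functional_choice preP.
pose F x := e' (f (b x)) (h (b x) (pre x)).
have FE i j : F (e i j) = e' (f i) (h i j).
  (* Generalising [e i j] to [x] lets [b x] replace [i], on which the type of [j] depends. *)
  move: (be i j) (erefl (e i j)); move: {1 3 4}(e i j) => x bx; subst i.
  rewrite -[X in _ = X](preK x); have [eO _ _] := eP (b x).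
  by move/(occurrence_inj eO) => ->.
have elimP (K : 'I_(plen (lperm p)) -> Prop) :
    (forall i j, K (e i j)) -> forall x, K x.
  by move=> Ke x; rewrite -(preK x).
exists F; split; last first.
  elim/elimP=> i j; rewrite FE.
  by have [_ _ ->] := eP i; have [_ _ ->] := e'P (f i); have [_] := hE i; apply.
suff ord x y : (F x < F y) = (x < y) /\
    (lperm p' (F x) < lperm p' (F y)) = (lperm p x < lperm p y).
  by split=> x y; have [] := ord x y => // ->.
elim/elimP: x => i j; elim/elimP: y => k l; rewrite !FE.
case: (eqVneq i k) => [ik|/eqP ik].
  subst k; have [eO _ _] := eP i; have [eO' _ _] := e'P (f i).
  have [hO _] := hE i.
  rewrite (occurrence_ltn eO) (occurrence_ltn eO') (occurrence_ltn hO).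
  by rewrite eO.2 eO'.2 hO.2.
have [] := bP (e i j) (e k l); rewrite ?be // => -> ->.
have [] := b'P (e' (f i) (h i j)) (e' (f k) (h k l)); rewrite ?be'.
  by move=> /finj.
by move=> -> ->; rewrite (occurrence_ltn fP) fP.2.
Qed.

(** Each block can be taken of length one or shorter than [p], so the two hypotheses on [Q] admit
    every block, labelled as in [p]. *)
Lemma decomposable_assembles (C : permutation -> Prop)
    (p : labelled_permutation L) (Q : labelled_permutation L -> Prop) :
  permutation_class C -> Reflexive leL -> decomposable C (lperm p) ->
  (forall q, decomposable C (lperm q) -> plen (lperm q) = 1 -> Q q) ->
  (forall q, decomposable C (lperm q) -> labelled_contained leL q p ->
     plen (lperm q) < plen (lperm p) -> Q q) ->
  exists2 w : labelled_permutation {q | Q q}, C (lperm w) &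
    assembles sval w p.
Proof.
move=> hC leL_refl Dp Q1 Qlt.
have [s [b [Cs bP small]]] := decomposable_proper Dp.
have blk i : exists (q : {q | Q q}) e,
    [/\ occurrence (lperm (sval q)) (lperm p) e,
    [set e x | x : 'I_(plen (lperm (sval q)))] = [set x | b x == i] &
    forall x, label (e x) = label x].
  have [a isoa] := exists_pattern [set x | b x == i].
  have lena := order_isomorphic_on_card isoa; have [f [fP fE]] := isoa.
  have Da : decomposable C a.
    by apply: (decomposable_class hC _ Dp); exists f.
  suff Qa : Q (@LabelledPermutation L a (@label L p \o f)).
    by exists (exist _ _ Qa), f.
  case: (small i) => bi; first by apply: Q1; rewrite //= lena.
  by apply: Qlt; rewrite //= ?lena //; exists f.
have [q qP] := functional_choice _ blk.
by exists (LabelledPermutation q) => //; exists b.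
Qed.

End Labelled.

Theorem theorem7p4 (C : permutation -> Prop) (hC : permutation_class C)
    (hL : lwqo C) : lwqo (substitution_closure C).
Proof.
move=> L leL wqoL; have [preL _] := wqoL; have [leL_refl _] := preL.
pose le := labelled_contained leL.
have preo : PreOrder le := labelled_contained_preorder preL.
have [le_refl le_tr] := preo.
pose D (p : labelled_permutation L) := decomposable C (lperm p).
suff goodD : good_on le D.
  split.
    split=> [p|p q r]; first exact: le_refl.
    exact: le_tr.
  move=> y; apply: (goodD (fun n => sval (y n))) => n.
  (* Membership in the closure is instantiated at the class [decomposable C]. *)
  apply: (svalP (y n) (decomposable C)).
  - exact: decomposable_class.
  - exact: decomposable_substitution_closed.
  - exact: decomposable_leaf.
apply: good_onPn => y0 /(minimal_bad_sequence (fun p => plen (lperm p))).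
move=> [y bady ymin]; have [Dy noy] := bady.
pose Q q := plen (lperm q) = 1 \/
  (D q /\ exists n, le q (y n) /\ plen (lperm q) < plen (lperm (y n))).
have goodQ : good_on le Q.
  apply: good_onU; first exact: good_on_short.
  exact: minimal_bad_sequence_good le_tr bady ymin.
have wqoQ : wqo (fun q q' : {q | Q q} => le (sval q) (sval q')).
  split; last by move=> z; apply: goodQ => n; apply: svalP.
  split=> [q|q q' q'']; first exact: le_refl.
  exact: le_tr.
have asm n : exists w : wreath C {q | Q q}, assembles sval (sval w) (y n).
  have [q _ q1|q Dq qy ltqy|w Cw wP] :=
    @decomposable_assembles _ leL C (y n) Q hC leL_refl (Dy n).
  - by left.
  - by right; split=> //; exists n.
  by exists (exist _ w Cw).
have [w wP] := functional_choice _ asm.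
have [_ /(_ w)[i [j [ij leij]]]] := hL _ _ wqoQ.
exact: (noy i j ij (assembles_contained (wP i) (wP j) leij)).
Qed.
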